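(* Let $p$ be a prime, $r \geq 1$ an integer, and $1 \leq a_1 \leq \dots \leq a_{r-1} < a_r$ integers, and let $G \simeq C_{p^{a_1}} \oplus \cdots \oplus C_{p^{a_r}}$. Then for every integer $\delta$ with $0 \leq \delta \leq \mathsf{d}(G)-1$, $$\Gamma_{\delta}(G)=\max\left(0,(p^{a_r}-1)-\delta-\left\lfloor \frac{\delta}{p-1} \right\rfloor\right).$$
   Context: $C_n$ denotes the cyclic group of order $n$. A sequence in a finite abelian group $G$ is a finite unordered list of elements of $G$ with repetition allowed; its length is the number of terms counted with multiplicity. A sequence is zero-sumfree if no nonempty subsequence has sum $0$. $\mathsf{d}(G)$ denotes the maximal length of a zero-sumfree sequence in $G$. An element has maximal order if its order equals the exponent $\exp(G)$. For an integer $0 \le \delta \le \mathsf{d}(G)-1$, $\Gamma_\delta(G)$ is the minimum, over all zero-sumfree sequences $S$ in $G$ with $|S| \geq \mathsf{d}(G)-\delta$, of the number of terms of $S$ (with multiplicity) of maximal order. *)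

(* Defs.v *)
From HB Require Import structures.
From mathcomp Require Import all_boot all_order all_algebra all_fingroup.
From mathcomp Require Import all_solvable.

Set Implicit Arguments.
Unset Strict Implicit.
Unset Printing Implicit Defensive.

Import Order.TTheory GRing.Theory Num.Theory.

Local Open Scope ring_scope.

(* A sequence over G is represented by an ordered seq G: every notion below is
   invariant under permutation of the terms. *)

Definition zero_sumfree (G : finZmodType) (S : seq G) : bool :=
  [forall m : (size S).-tuple bool,
     (mask m S != [::]) ==> (\sum_(x <- mask m S) x != 0)].

Lemma zero_sumfreeP (G : finZmodType) (S : seq G) :
  reflect (forall T : seq G, subseq T S -> T <> [::] -> \sum_(x <- T) x <> 0)
          (zero_sumfree S).
Proof.
apply: (iffP forallP) => [zS T /subseqP[m sz_m ->] /eqP nz|zS m].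
  apply/eqP.
  by have := zS (Tuple (introT eqP sz_m)); rewrite /= nz.
apply/implyP => /eqP nz; apply/eqP; apply: zS => //.
by apply/subseqP; exists m; rewrite ?size_tuple.
Qed.

Lemma zero_sumfree_nil (G : finZmodType) : zero_sumfree ([::] : seq G).
Proof. by apply/zero_sumfreeP => T; rewrite subseq0 => /eqP. Qed.

(* The partial sums of a zero-sumfree sequence are pairwise distinct. *)
Lemma zero_sumfree_size (G : finZmodType) (S : seq G) :
  zero_sumfree S -> (size S < #|G|)%N.
Proof.
move=> /zero_sumfreeP zS.
pose f (k : 'I_(size S).+1) := \sum_(x <- take k S) x.
have f_lt (i j : 'I_(size S).+1) : (i < j)%N -> f i <> f j.
  move=> lt_ij; rewrite /f => /esym.
  rewrite -[take j S](cat_take_drop i) big_cat /= take_takel ?(ltnW lt_ij) //.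
  move/(congr1 (fun y => y - \sum_(x <- take i S) x)).
  rewrite addrAC subrr add0r; apply: zS.
    exact: subseq_trans (drop_subseq _ _) (take_subseq _ _).
  move/(congr1 size); rewrite size_drop size_takel; last by rewrite -ltnS.
  by move/eqP; rewrite subn_eq0 leqNgt lt_ij.
have f_inj : injective f.
  move=> i j eq_f; apply/val_inj; apply/eqP.
  by case: ltngtP => // /f_lt; rewrite eq_f.
by have := leq_card f f_inj; rewrite card_ord.
Qed.

Definition has_max_order (G : finZmodType) (x : G) : bool :=
  #[x]%g == exponent [set: G].

Definition has_zero_sumfree_of_size (G : finZmodType) (n : nat) : bool :=
  [exists S : n.-tuple G, zero_sumfree S].

Lemma has_zero_sumfree_of_sizeP (G : finZmodType) (n : nat) :
  reflect (exists2 S : seq G, zero_sumfree S & size S = n)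
          (has_zero_sumfree_of_size G n).
Proof.
apply: (iffP existsP) => [[S zS]|[S zS /eqP sz]].
  by exists S; rewrite ?size_tuple.
by exists (Tuple sz).
Qed.

Lemma ex_zero_sumfree (G : finZmodType) :
  exists n, has_zero_sumfree_of_size G n.
Proof.
by exists 0; apply/has_zero_sumfree_of_sizeP; exists [::] => //;
  apply: zero_sumfree_nil.
Qed.

Lemma zero_sumfree_bounded (G : finZmodType) (n : nat) :
  has_zero_sumfree_of_size G n -> (n <= #|G|)%N.
Proof.
by case/has_zero_sumfree_of_sizeP => S /zero_sumfree_size/ltnW le_S <-.
Qed.

(* d(G) *)
Definition small_davenport (G : finZmodType) : nat :=
  ex_maxn (ex_zero_sumfree G) (@zero_sumfree_bounded G).

Lemma small_davenport_ex (G : finZmodType) :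
  exists2 S : seq G, zero_sumfree S & size S = small_davenport G.
Proof.
rewrite /small_davenport; case: ex_maxnP => n.
by move=> /has_zero_sumfree_of_sizeP.
Qed.

Lemma small_davenport_ub (G : finZmodType) (S : seq G) :
  zero_sumfree S -> (size S <= small_davenport G)%N.
Proof.
move=> zS; rewrite /small_davenport; case: ex_maxnP => n _; apply.
by apply/has_zero_sumfree_of_sizeP; exists S.
Qed.

(* Some zero-sumfree S with |S| >= d(G) - delta has exactly k terms of maximal
   order; by zero_sumfree_size, bounding |S| by #|G| excludes no sequence. *)
Definition is_max_order_count (G : finZmodType) (delta k : nat) : bool :=
  [exists S : {bseq #|G| of G},
     [&& zero_sumfree S, (small_davenport G - delta <= size S)%N
       & count (@has_max_order G) S == k]].

Lemma is_max_order_countP (G : finZmodType) (delta k : nat) :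
  reflect (exists S : seq G,
             [/\ zero_sumfree S, (small_davenport G - delta <= size S)%N
               & count (@has_max_order G) S = k])
          (is_max_order_count G delta k).
Proof.
apply: (iffP existsP) => [[S /and3P[zS le_S /eqP cS]]|[S [zS le_S cS]]].
  by exists S.
have szS : (size S <= #|G|)%N by apply/ltnW/zero_sumfree_size.
by exists (Bseq szS); rewrite /= zS le_S cS eqxx.
Qed.

Lemma ex_max_order_count (G : finZmodType) (delta : nat) :
  exists k, is_max_order_count G delta k.
Proof.
have [S zS szS] := small_davenport_ex G.
exists (count (@has_max_order G) S); apply/is_max_order_countP; exists S.
by split=> //; rewrite szS leq_subr.
Qed.

(* Gamma_delta(G) *)
Definition Gamma (delta : nat) (G : finZmodType) : nat :=
  ex_minn (ex_max_order_count G delta).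

Lemma Gamma_ex (delta : nat) (G : finZmodType) :
  exists S : seq G,
    [/\ zero_sumfree S, (small_davenport G - delta <= size S)%N
      & count (@has_max_order G) S = Gamma delta G].
Proof.
rewrite /Gamma; case: ex_minnP => k.
by move=> /is_max_order_countP.
Qed.

Lemma Gamma_lb (delta : nat) (G : finZmodType) (S : seq G) :
  zero_sumfree S -> (small_davenport G - delta <= size S)%N ->
  (Gamma delta G <= count (@has_max_order G) S)%N.
Proof.
move=> zS le_S; rewrite /Gamma; case: ex_minnP => k _; apply.
by apply/is_max_order_countP; exists S.
Qed.

(* Main.v *)
Require Import Defs.
From HB Require Import structures.
From mathcomp Require Import all_boot all_order all_algebra all_fingroup.
From mathcomp Require Import all_solvable zify.

Import Order.TTheory GRing.Theory Num.Theory.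

Local Open Scope ring_scope.

(** Write [n = p ^ a r].  Because the largest exponent is attained only once,
    the elements that do not have maximal order form a subgroup [H] of index
    [p], of type (a_1, ..., a_{r-1}, a_r - 1).

    Lower bound: among any [p] terms of a zero-sumfree sequence some nonempty
    block has its sum in [H], so a sequence with [k] terms outside [H] and [l]
    inside yields a zero-sumfree sequence in [H] of length at least
    [l + k %/ p], which is at most d(H).  Upper bound: take each basis element
    e_i, i < r, p^a_i - 1 times, e_r [u] times and p e_r [v] times, where
    [u + p * v < n].

    Both use Olson's theorem d = \sum (p^a_i - 1).  Its upper bound comes from
    difference operators on functions G -> F_p: an iterated difference along
    more than \sum (p^a_i - 1) directions vanishes, since the p^a_i-th
    difference along e_i does, whereas along a zero-sumfree sequence the
    indicator of 0 has iterated difference 1 or -1 at 0. *)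

Set Implicit Arguments.
Unset Strict Implicit.
Unset Printing Implicit Defensive.

(** * Difference operators *)

Section Differences.

Variables (G R : zmodType).
Implicit Types (f : G -> R) (g x y : G) (s t : seq G).

Definition diff g f y := f (y + g) - f y.

Definition diffs s f := foldr diff f s.

Lemma eq_diff g f f' : f =1 f' -> diff g f =1 diff g f'.
Proof. by move=> eqf y; rewrite /diff !eqf. Qed.

Lemma eq_diffs s f f' : f =1 f' -> diffs s f =1 diffs s f'.
Proof. by move=> eqf; elim: s => //= g s IHs; apply: eq_diff. Qed.

Lemma diffs_cat s t f : diffs (s ++ t) f = diffs s (diffs t f).
Proof. exact: foldr_cat. Qed.

Lemma diffC g h f : diff g (diff h f) =1 diff h (diff g f).
Proof.
move=> y; rewrite /diff [y + h + g]addrAC !opprD !opprK !addrA.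
by congr (_ + _); apply: addrAC.
Qed.

Lemma diffs_diff s g f : diffs s (diff g f) =1 diff g (diffs s f).
Proof.
elim: s => //= h s IHs y.
by rewrite (eq_diff h IHs) diffC.
Qed.

Lemma perm_diffs s t f : perm_eq s t -> diffs s f =1 diffs t f.
Proof.
elim: s t => [|x s IHs] t.
  by rewrite perm_sym => /perm_nilP->.
move=> eq_st y; have x_t : x \in t by rewrite -(perm_mem eq_st) mem_head.
case/splitPr: x_t eq_st => t1 t2 eq_st.
rewrite perm_sym -(cat1s x t2) perm_catCA cat1s perm_cons perm_sym in eq_st.
rewrite /= (eq_diff x (IHs _ eq_st)) !diffs_cat /=.
by rewrite diffs_diff.
Qed.

Lemma diffs0 s f : f =1 (fun=> 0) -> diffs s f =1 (fun=> 0).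
Proof.
move=> f0; elim: s => //= g s IHs y.
by rewrite (eq_diff g IHs) /diff subrr.
Qed.

Lemma diffs_shift s f x y : diffs s (fun z => f (z + x)) y = diffs s f (y + x).
Proof.
by elim: s y => //= g s IHs y; rewrite /diff !IHs addrAC.
Qed.

Lemma diffsD s f f' y :
  diffs s (fun z => f z + f' z) y = diffs s f y + diffs s f' y.
Proof.
elim: s y => //= g s IHs y; rewrite /diff !IHs opprD !addrA.
by congr (_ - _); rewrite -!addrA; congr (_ + _); rewrite addrC.
Qed.

(* [diff] is additive in the direction up to shifts, so it suffices to kill the
   generators. *)
Lemma diffs_diff_span (I : finType) (e : I -> G) (c : I -> nat) s :
  (forall i f y, diffs s (diff (e i) f) y = 0) ->
  forall f y, diffs s (diff (\sum_i e i *+ c i) f) y = 0.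
Proof.
move=> se0; have D0 : forall f y, diffs s (diff 0 f) y = 0.
  by move=> f; apply: diffs0 => y; rewrite /diff addr0 subrr.
have DD x x' : (forall f y, diffs s (diff x f) y = 0) ->
    (forall f y, diffs s (diff x' f) y = 0) ->
    forall f y, diffs s (diff (x + x') f) y = 0.
  move=> Dx Dx' f y.
  rewrite (@eq_diffs _ _ (fun z => diff x' (fun w => f (w + x)) z + diff x f z)).
    by rewrite diffsD Dx Dx' addr0.
  by move=> z; rewrite /diff [RHS]addrA subrK [x + x']addrC addrA.
apply: (big_ind (fun x => forall f y, diffs s (diff x f) y = 0)) => // i _.
elim: (c i) => [|n IHn]; first by rewrite mulr0n.
by rewrite mulrS; apply: DD.
Qed.

(** The iterated difference is a signed sum of the values of [f] at [y] plus each subsum of [s];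
    only the empty subsum contributes, with sign (-1)^|s|. *)
Lemma diffs_subsums s f y :
  (forall t, subseq t s -> t <> [::] -> f (y + \sum_(x <- t) x) = 0) ->
  diffs s f y = f y *~ (-1) ^+ size s.
Proof.
elim: s y => [|x s IHs] y sf0 /=; first by rewrite expr0.
rewrite /diff !IHs.
- rewrite exprS mulN1r mulrNz; have := sf0 [:: x].
  by rewrite big_seq1 => ->; rewrite ?mul0rz ?sub0r // sub1seq mem_head.
- by move=> t st; apply: sf0; apply: subseq_trans st (subseq_cons _ _).
move=> t st _; have := sf0 (x :: t); rewrite big_cons addrA => -> //.
by rewrite /= eqxx.
Qed.

End Differences.

(** Translation by [g] acts as X, hence [diff g] as X - 1. *)
Lemma diffs_nseq_coef (G : zmodType) (R : nzRingType) (g : G) n (f : G -> R) y :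
  diffs (nseq n g) f y =
  \sum_(i < n.+1) (('X - 1%:P) ^+ n)`_i * f (y + g *+ i).
Proof.
elim: n y => [|n IHn] y /=.
  by rewrite big_ord1 expr0 coef1 mul1r mulr0n addr0.
rewrite /diff !IHn exprSr mulrBr mulr1.
under [RHS]eq_bigr do rewrite coefB coefMX mulrBl.
rewrite sumrB; congr (_ - _).
  rewrite [RHS]big_ord_recl /= mul0r add0r; apply: eq_bigr => i _.
  by rewrite /bump /= mulrS addrA.
rewrite [RHS]big_ord_recr /= nth_default ?mul0r ?addr0 //.
by rewrite size_exp_XsubC.
Qed.

(** In characteristic p, (X - 1)^(p^b) = X^(p^b) - 1, and the remaining difference along p^b g = 0
    vanishes. *)
Lemma diffs_nseq_pfactor (G : zmodType) (p b : nat) (g : G) (f : G -> 'F_p) y :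
  prime p -> g *+ (p ^ b)%N = 0 -> diffs (nseq (p ^ b) g) f y = 0.
Proof.
move=> p_pr gb0; rewrite diffs_nseq_coef.
have chp : p \in [pchar {poly 'F_p}] by rewrite pchar_poly pchar_Fp.
have -> : ('X - 1%:P) ^+ (p ^ b)%N = 'X^(p ^ b) - 1 :> {poly 'F_p}.
  elim: b {gb0} => [|b IHb]; first by rewrite expn0 !expr1.
  rewrite expnSr exprM IHb -(pFrobenius_autE chp).
  by rewrite (pFrobenius_autB_comm _ (mulrC _ _)) !pFrobenius_autE -exprM expr1n.
have pb_gt0 : (0 < p ^ b)%N by rewrite expn_gt0 prime_gt0.
case def_n: (p ^ b)%N pb_gt0 => [//|n] _; rewrite def_n in gb0.
rewrite big_ord_recl big_ord_recr /= /bump /= big1 => [|i _].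
  rewrite !coefB !coefXn !coef1 !add1n gb0 eqxx mulr0n.
  by rewrite sub0r subr0 mul1r mulN1r add0r addNr.
rewrite coefB coefXn coef1 add1n (ltn_eqF (_ : i.+1 < n.+1)%N) ?ltnS //.
by rewrite subrr mul0r.
Qed.

(** * Olson's bound *)

Section Olson.

Variables (p : nat) (G : finZmodType) (I : finType) (e : I -> G) (b : I -> nat).
Hypotheses (p_pr : prime p) (eb0 : forall i, e i *+ (p ^ b i)%N = 0).

(** Induction on [s] trades each arbitrary direction for a basis one, collected in [t], and keeps
    the total length. Once [s] is empty, the pigeonhole principle gives an [i] occurring at least
    p^b_i times. *)
Lemma diffs_vanish (t : seq I) (s : seq G) (f : G -> 'F_p) y :
  (forall x, x \in s -> exists c : I -> nat, x = \sum_i e i *+ c i) ->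
  (\sum_i (p ^ b i - 1) < size t + size s)%N ->
  diffs (map e t ++ s) f y = 0.
Proof.
elim: s t f y => [|x s IHs] t f y spans ltD.
  have [i le_i] : exists i, (p ^ b i <= count_mem i t)%N.
    apply/existsP; apply: contraLR ltD; rewrite negb_exists => /forallP lt_t.
    rewrite -leqNgt addn0 -sum1_size.
    rewrite (partition_big id xpredT) //=; apply: leq_sum => i _.
    rewrite sum1_count; have := lt_t i; rewrite -ltnNge.
    by case: (p ^ b i)%N => // n; rewrite subn1.
  have [t' /perm_diffs->] : exists t', perm_eq (map e t ++ [::])
      (nseq (p ^ b i) (e i) ++ t').
    exists (nseq (count_mem i t - p ^ b i) (e i) ++ map e (filter (predC1 i) t)).
    rewrite cats0 catA -nseqD subnKC // -map_nseq -map_cat perm_sym.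
    have -> : nseq (count_mem i t) i = filter (pred1 i) t.
      by rewrite -size_filter; apply/esym/all_pred1P/filter_all.
    by apply: perm_map; rewrite perm_filterC.
  by rewrite diffs_cat diffs_nseq_pfactor.
have [c ->] := spans x (mem_head _ _).
rewrite (perm_diffs _ (t := (map e t ++ s) ++ [:: \sum_i e i *+ c i])); last first.
  by rewrite -catA perm_cat2l -cat1s perm_catC.
rewrite diffs_cat; apply: diffs_diff_span => i {}f {}y.
rewrite diffs_diff; apply: (IHs (i :: t)); last by rewrite addSnnS.
by move=> z sz; apply: spans; rewrite inE sz orbT.
Qed.

(** Stated for sequences in the span of [e], so that it serves for the whole group, for the subgroup
    of elements of non-maximal order and for a cyclic subgroup of order p. *)
Lemma zero_sumfree_size_span (S : seq G) :
  zero_sumfree S ->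
  (forall x, x \in S -> exists c : I -> nat, x = \sum_i e i *+ c i) ->
  (size S <= \sum_i (p ^ b i - 1))%N.
Proof.
move=> /zero_sumfreeP zS spanS; rewrite leqNgt; apply/negP => ltS.
have := @diffs_vanish [::] S (fun y => (y == 0)%:R) 0 spanS ltS.
rewrite /= diffs_subsums => [|t st nt]; last first.
  by rewrite add0r; case: eqP => // /(zS t st nt).
rewrite eqxx -signr_odd; case: (odd _) => /= /eqP.
  by rewrite expr1 mulrN1z oppr_eq0 oner_eq0.
by rewrite expr0 mulr1z oner_eq0.
Qed.

End Olson.

(** * Operations on zero-sumfree sequences *)

Section ZeroSumfree.

Variable G : finZmodType.
Implicit Types S T U : seq G.

Lemma zero_sumfree_sub S T :
  zero_sumfree S -> (forall x, count_mem x T <= count_mem x S)%N ->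
  zero_sumfree T.
Proof.
move=> /zero_sumfreeP zS leTS; apply/zero_sumfreeP => U sUT ntU.
have [V sVS eqUV] : exists2 V, subseq V S & perm_eq U V.
  apply/count_subseqP => x; apply: leq_trans (leTS x).
  exact: leq_count_subseq.
rewrite (perm_big _ eqUV); apply: zS => // V0; apply: ntU.
by apply/nilP; rewrite /nilp (perm_size eqUV) V0.
Qed.

Lemma zero_sumfree_merge T U :
  zero_sumfree (T ++ U) -> T <> [::] -> zero_sumfree (\sum_(x <- T) x :: U).
Proof.
move=> /zero_sumfreeP zTU ntT; apply/zero_sumfreeP => -[|y V] //=.
case: eqP => [-> sVU|_ sVU] _.
  rewrite big_cons -big_cat; apply: zTU; first by apply: cat_subseq.
  by case: (T) ntT.
by apply: zTU => //; apply: subseq_trans sVU (suffix_subseq _ _).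
Qed.

(* Every [p] terms contain a block with sum in [H]; replacing it by its sum
   costs at most [p] terms outside [H] and gains one inside. *)
Lemma zero_sumfree_blocks (p : nat) (H : pred G) S T :
  (0 < p)%N ->
  (forall U, size U = p ->
     exists V, [/\ subseq V U, V <> [::] & H (\sum_(x <- V) x)]) ->
  zero_sumfree (S ++ T) -> all H T ->
  exists U, [/\ zero_sumfree U, all H U & (size T + size S %/ p <= size U)%N].
Proof.
move=> p_gt0 blockP.
have [n] := ubnP (size S); elim: n => // n IHn in S T * => ltSn zST HT.
have [ltSp|lepS] := ltnP (size S) p.
  exists T; split=> //; last by rewrite divn_small // addn0.
  by apply: zero_sumfree_sub zST _ => x; rewrite count_cat leq_addl.
have [V [sV ntV HV]] := blockP (take p S) (size_takel lepS).
have [W eqS] : exists W, perm_eq S (V ++ W).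
  have [W eqW] := perm_to_subseq (subseq_trans sV (take_subseq _ _)).
  by exists W.
have leVp : (size V <= p)%N by rewrite -(size_takel lepS) size_subseq.
have V_gt0 : (0 < size V)%N by rewrite lt0n; apply/negP => /nilP.
have szS : size S = (size V + size W)%N by rewrite (perm_size eqS) size_cat.
have [|||U [zU HU leU]] := IHn W (\sum_(x <- V) x :: T) _ _ _.
- by rewrite -ltnS (leq_trans _ ltSn) // szS ltnS -[X in (X < _)%N]add0n ltn_add2r.
- have zVWT : zero_sumfree (V ++ (W ++ T)).
    apply: zero_sumfree_sub zST _ => x.
    by rewrite catA !count_cat (seq.permP eqS) count_cat.
  apply: zero_sumfree_sub (zero_sumfree_merge zVWT ntV) _ => x.
  by rewrite /= !count_cat /= addnCA.
- by rewrite /= HV.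
exists U; split=> //; apply: leq_trans leU; rewrite /= addSnnS leq_add2l.
(* Since |V| <= p, removing [V] lowers the quotient by at most one, which the new term makes up
   for. *)
have -> : (size W %/ p).+1 = ((p + size W) %/ p)%N.
  by rewrite divnDl // divnn p_gt0 add1n.
by rewrite szS leq_div2r // leq_add2r.
Qed.

End ZeroSumfree.

(** * Arithmetic of the two bounds *)

(** Here h = p^(a_r - 1), [rest] is the sum of p^a_i - 1 over i < r, and [k] and [l] count the terms
    outside and inside H. *)
Lemma max_order_count_arith (p h rest d k l : nat) :
  (1 < p)%N -> (0 < h)%N ->
  (rest + (p * h - 1) - d <= k + l)%N -> (l + k %/ p <= rest + (h - 1))%N ->
  (p * h - 1 - d - d %/ (p - 1) <= k)%N.
Proof.
case: p => [|q] //; rewrite ltnS subSS subn0 => q_gt0 h_gt0.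
have := divn_eq k q.+1; have := ltn_pmod k (ltn0Sn q).
have := divn_eq d q; have := ltn_pmod d q_gt0.
move: (k %/ _)%N (k %% _)%N (d %/ _)%N (d %% _)%N => A s j t lt_t -> lt_s -> le1 le2.
(* With k = A p + s and d = j (p - 1) + t, the hypotheses give (p - 1)(h - j - A) <= s + t < 2 (p -
   1), so h - j - A is at most 1; the value 1 is the tight case. *)
have [le_h|lt_h] := leqP h (j + A)%N; first by nia.
have [eq_h|lt_h'] := leqP h (j + A).+1%N; last by nia.
have -> : h = (j + A).+1%N by lia.
have {}le1 : (q * (j + A).+1 <= j * q + t + A * q + s)%N by nia.
nia.
Qed.
(** Starting from p h - 1 copies of e_r, exchanging p copies for one p e_r shortens the sequence by
    p - 1. A loss of [d] pays for d / (p - 1) exchanges, rounded down, and the remainder deletes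
    copies of e_r. *)
Lemma max_order_witness_arith (p h d : nat) :
  (1 < p)%N -> (0 < h)%N ->
  exists u v, [/\ (u + p * v < p * h)%N, (p * h - 1 - d <= u + v)%N
                & u = (p * h - 1 - d - d %/ (p - 1))%N].
Proof.
case: p => [|q] //; rewrite ltnS subSS subn0 => q_gt0 h_gt0.
have := divn_eq d q; have := ltn_pmod d q_gt0.
move: (d %/ _)%N (d %% _)%N => j t lt_t ->.
exists (q.+1 * h - 1 - (j * q + t) - j)%N.
have [lt_jh|le_hj] := ltnP j h.
  by exists j; split=> //; nia.
(* Only h - 1 copies of p e_r fit, and no e_r is left. *)
by exists h.-1; split=> //; nia.
Qed.

(** * Groups with a basis of prime power orders *)

Section Basis.

Variables (p : nat) (G : finZmodType) (I : finType) (e : I -> G) (b : I -> nat).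
Variable i0 : I.
Hypotheses (p_pr : prime p) (eb0 : forall i, e i *+ (p ^ b i)%N = 0).
Hypothesis e_gen : forall x, exists c : I -> nat, x = \sum_i e i *+ c i.
Hypothesis e_indep : forall c : I -> nat,
  \sum_i e i *+ c i = 0 -> forall i, (p ^ b i %| c i)%N.
Hypotheses (b_gt0 : (0 < b i0)%N) (b_lt : forall i, i != i0 -> (b i < b i0)%N).

Let h := (p ^ (b i0).-1)%N.
Let rest := (\sum_(i | i != i0) (p ^ b i - 1))%N.

Let pn_eq : (p ^ b i0 = p * h)%N.
Proof. by rewrite /h -expnS prednK. Qed.

Lemma mulrn_nontop i : i != i0 -> e i *+ h = 0.
Proof.
move=> ne_i; have /dvdnP[k ->] : (p ^ b i %| h)%N.
  by rewrite dvdn_exp2l // -ltnS prednK // b_lt.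
by rewrite mulnC mulrnA eb0 mul0rn.
Qed.

Lemma mulrn_top (c : I -> nat) :
  (\sum_i e i *+ c i) *+ h = e i0 *+ (c i0 * h).
Proof.
rewrite -sumrMnl (bigD1 i0) //= big1 ?addr0 -?mulrnA // => i ne_i.
by rewrite mulrnAC mulrn_nontop // mul0rn.
Qed.

Lemma mulrn_top_dvd k : e i0 *+ k = 0 -> (p ^ b i0 %| k)%N.
Proof.
move=> ek0; have := @e_indep (fun i => if i == i0 then k else 0)%N _ i0.
rewrite eqxx; apply; rewrite (bigD1 i0) //= eqxx ek0 add0r big1 // => i.
by move/negPf->.
Qed.

(** Every order divides p^(b i0), the order of [e i0] and hence the exponent, so a smaller order
    divides [h]. Thus H is the kernel of multiplication by [h]. *)
Lemma has_max_orderE (x : G) : has_max_order x = (x *+ h != 0).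
Proof.
have ordE (y : G) m : (#[y]%g %| m)%N = (y *+ m == 0).
  by rewrite order_dvdn FinRing.zmodXgE.
have kill (y : G) : y *+ (p ^ b i0)%N = 0.
  have [c ->] := e_gen y.
  rewrite pn_eq mulnC mulrnA mulrn_top -mulrnA -mulnA [(h * p)%N]mulnC -pn_eq.
  by rewrite mulnC mulrnA eb0 mul0rn.
have -> : has_max_order x = (#[x]%g == (p ^ b i0)%N).
  rewrite /has_max_order; congr (_ == _); apply/eqP; rewrite eqn_dvd.
  apply/andP; split.
    by apply/exponentP => y _; apply/eqP; rewrite -order_dvdn ordE kill.
  apply: dvdn_trans (dvdn_exponent (in_setT (e i0))).
  by apply: mulrn_top_dvd; apply/eqP; rewrite -ordE.
have /(dvdn_pfactor _ _ p_pr)[k le_k ox] : (#[x]%g %| p ^ b i0)%N.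
  by rewrite ordE kill.
rewrite -ordE ox eqn_exp2l ?prime_gt1 // /h dvdn_Pexp2l ?prime_gt1 //.
by rewrite -ltnS prednK // -leqNgt eqn_leq le_k.
Qed.

Lemma nonmax_size (S : seq G) :
  zero_sumfree S -> all (predC (@has_max_order G)) S ->
  (size S <= rest + (h - 1))%N.
Proof.
move=> zS /allP nmS.
(* H is spanned by the basis with [e i0] replaced by its multiple by p. *)
pose e' i := if i == i0 then e i0 *+ p else e i.
pose b' i := if i == i0 then (b i0).-1 else b i.
have -> : (rest + (h - 1) = \sum_i (p ^ b' i - 1))%N.
  rewrite [RHS](bigD1 i0) //= /b' eqxx addnC; congr (_ + _)%N.
  by apply: eq_bigr => i /negPf->.
apply: (@zero_sumfree_size_span _ _ _ e') => // [i|x Sx].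
  by rewrite /e' /b'; case: eqP => // _; rewrite -mulrnA -pn_eq eb0.
have [c def_x] := e_gen x.
have : (p ^ b i0 %| c i0 * h)%N.
  have := nmS x Sx; rewrite /= has_max_orderE negbK def_x mulrn_top => /eqP.
  exact: mulrn_top_dvd.
rewrite pn_eq dvdn_pmul2r ?expn_gt0 ?prime_gt0 // => /dvdnP[k ck].
exists (fun i => if i == i0 then k else c i).
rewrite def_x (bigD1 i0) //= [RHS](bigD1 i0) //= /e' eqxx ck mulnC mulrnA.
by congr (_ + _); apply: eq_bigr => i /negPf->.
Qed.

(** Multiplication by [h] maps G into the cyclic group generated by h e_i0, where p terms are too
    many to be zero-sumfree; its kernel is H. *)
Lemma max_order_block (U : seq G) :
  size U = p ->
  exists V, [/\ subseq V U, V <> [::] & predC (@has_max_order G) (\sum_(x <- V) x)].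
Proof.
move=> szU.
have : ~~ zero_sumfree [seq x *+ h | x <- U].
  apply/negP => zU.
  have : (size [seq x *+ h | x <- U] <= \sum_(i < 1) (p ^ 1 - 1))%N.
    apply: (@zero_sumfree_size_span p G _ (fun=> e i0 *+ h) (fun=> 1%N)) => //.
      by move=> _; rewrite -mulrnA mulnC -pn_eq eb0.
    move=> _ /mapP[x _ ->]; have [c ->] := e_gen x; exists (fun=> c i0).
    by rewrite big_ord1 mulrn_top mulnC mulrnA.
  by rewrite big_ord1 expn1 size_map szU subn1 leqNgt prednK ?prime_gt0 // leqnn.
case/forallPn => m; rewrite negb_imply negbK -map_mask big_map.
move=> /andP[nt /eqP sum0].
exists (mask m U); split; first exact: mask_subseq.
  by move=> m0; rewrite m0 in nt.
by rewrite /= has_max_orderE negbK -sumrMnl sum0.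
Qed.

(** A pair (i, m) stands for the term m e_i. In a vanishing subsum the total weight at each i is
    divisible by p^b_i yet smaller than it, hence zero, while all weights are positive. *)
Lemma zero_sumfree_weighted (W : seq (I * nat)) :
  (forall w, w \in W -> 0 < w.2)%N ->
  (forall i, \sum_(w <- W | w.1 == i) w.2 < p ^ b i)%N ->
  zero_sumfree [seq e w.1 *+ w.2 | w <- W].
Proof.
move=> W_gt0 W_lt; apply/forallP => m; apply/implyP.
rewrite -map_mask; set W' := mask m W => nt; apply: contra nt; rewrite big_map.
have -> : \sum_(w <- W') e w.1 *+ w.2 =
    \sum_i e i *+ (\sum_(w <- W' | w.1 == i) w.2).
  rewrite (partition_big (fun w => w.1) xpredT) //=; apply: eq_bigr => i _.
  by rewrite -sumrMnr; apply: eq_bigr => w /eqP->.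
move=> /eqP/e_indep dvdW.
have sub_le i : (\sum_(w <- W' | w.1 == i) w.2 <= \sum_(w <- W | w.1 == i) w.2)%N.
  rewrite /W'; elim: (W) (val m) => [|w W2 IH] [|[] m'] //=; rewrite ?big_nil //.
  - by rewrite !big_cons; case: ifP => _; rewrite ?leq_add2l IH.
  - by rewrite big_cons; case: ifP => _; rewrite ?(leq_trans (IH m')) ?leq_addl.
case def_W' : W' => [//|w W2].
have W'w : w \in W' by rewrite def_W' mem_head.
have w_gt0 : (0 < \sum_(w' <- W' | w'.1 == w.1) w'.2)%N.
  rewrite def_W' big_cons eqxx ltn_addr // W_gt0 //.
  exact: (mem_mask W'w).
have := dvdn_leq w_gt0 (dvdW w.1).
by rewrite leqNgt (leq_ltn_trans (sub_le _) (W_lt _)).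
Qed.

(** Only the [u] copies of [e i0] can have maximal order: multiplication by [h] kills p e_i0 and the
    other basis elements. *)
Lemma ex_zero_sumfree_few_max (u v : nat) :
  (u + p * v < p ^ b i0)%N ->
  exists S : seq G, [/\ zero_sumfree S, size S = (rest + u + v)%N
                      & (count (@has_max_order G) S <= u)%N].
Proof.
move=> uv_lt.
pose W0 := flatten [seq nseq (p ^ b i - 1) (i, 1%N) | i <- enum (predC1 i0)].
pose W := W0 ++ nseq u (i0, 1%N) ++ nseq v (i0, p).
have W0P w : w \in W0 -> w.1 != i0 /\ w.2 = 1%N.
  case/flattenP => s /mapP[i]; rewrite mem_enum inE => ne_i ->.
  by rewrite mem_nseq => /andP[_ /eqP->].
exists [seq e w.1 *+ w.2 | w <- W]; split.
- apply: zero_sumfree_weighted => [w|i].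
    rewrite !mem_cat !mem_nseq => /or3P[/W0P[_ ->]|/andP[_ /eqP->]|] //.
    by case/andP=> _ /eqP->; apply: prime_gt0.
  rewrite !big_cat /= !big_nseq_cond /=.
  have [<-|ne_i] := eqVneq i0 i.
    rewrite !iter_addn_0 mul1n big_seq_cond big1 // => w.
    by case/andP=> /W0P[/negPf->].
  rewrite eq_sym in ne_i.
  rewrite addn0 big_flatten big_map big_enum (bigD1 i) //=.
  rewrite big_nseq_cond eqxx iter_addn_0 mul1n big1 => [|j /andP[_ /negPf ne_j]].
    by rewrite !addn0 ltn_subrL /= expn_gt0 prime_gt0.
  by rewrite big_nseq_cond ne_j.
- rewrite size_map !size_cat !size_nseq addnA; congr (_ + _ + _)%N.
  rewrite size_flatten sumnE !big_map big_enum; apply: eq_bigr => i _.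
  by rewrite size_nseq.
rewrite count_map !count_cat; set P := preim _ _.
have nP w : ~~ P w = (e w.1 *+ w.2 *+ h == 0).
  by rewrite /P /= has_max_orderE negbK.
have -> : count P W0 = 0%N.
  apply/eqP; rewrite -leqn0 leqNgt -has_count; apply/hasPn => w /W0P[ne_w w1].
  by rewrite nP w1 mulrn_nontop.
have -> : count P (nseq v (i0, p)) = 0%N.
  apply/eqP; rewrite -leqn0 leqNgt -has_count; apply/hasPn => w.
  by rewrite mem_nseq nP => /andP[_ /eqP->] /=; rewrite -mulrnA -pn_eq eb0.
by rewrite addn0 (leq_trans (count_size _ _)) // size_nseq.
Qed.

Let h_gt0 : (0 < h)%N. Proof. by rewrite expn_gt0 prime_gt0. Qed.

Lemma small_davenport_basis : small_davenport G = (rest + (p * h - 1))%N.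
Proof.
apply/eqP; rewrite eqn_leq; apply/andP; split.
  have [S zS <-] := small_davenport_ex G.
  have <- : (\sum_i (p ^ b i - 1) = rest + (p * h - 1))%N.
    by rewrite (bigD1 i0) //= addnC pn_eq.
  exact: (@zero_sumfree_size_span p _ _ e).
(* With v = 0 this is the sequence of all e_i, each taken p^b_i - 1 times. *)
have [|S [zS szS _]] := @ex_zero_sumfree_few_max (p * h - 1) 0.
  by rewrite muln0 addn0 subn1 pn_eq prednK // muln_gt0 prime_gt0.
by rewrite -[X in (X <= _)%N]addn0 -szS small_davenport_ub.
Qed.

Lemma max_order_count_lb (delta : nat) (S : seq G) :
  zero_sumfree S -> (small_davenport G - delta <= size S)%N ->
  (p * h - 1 - delta - delta %/ (p - 1) <= count (@has_max_order G) S)%N.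
Proof.
move=> zS; rewrite small_davenport_basis => le_S.
pose M := @has_max_order G.
(* Only the first part is cut into blocks, so the terms of maximal order come first. *)
have zMS : zero_sumfree (filter M S ++ filter (predC M) S).
  apply: zero_sumfree_sub zS _ => x.
  by rewrite (seq.permP (permEl (perm_filterC M S))).
have [U [zU nmU leU]] := zero_sumfree_blocks (prime_gt0 p_pr) max_order_block
                           zMS (filter_all _ _).
have := leq_trans leU (nonmax_size zU nmU); rewrite !size_filter.
apply: max_order_count_arith; rewrite ?prime_gt1 //.
by rewrite -/M count_predC.
Qed.

Lemma Gamma_basis (delta : nat) :
  Gamma delta G = (p ^ b i0 - 1 - delta - delta %/ (p - 1))%N.
Proof.
rewrite pn_eq; apply/eqP; rewrite eqn_leq; apply/andP; split; last first.
  have [S [zS le_S <-]] := Gamma_ex delta G.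
  exact: max_order_count_lb.
have [u [v [uv_lt le_uv <-]]] :=
  max_order_witness_arith delta (prime_gt1 p_pr) h_gt0.
have [|S [zS szS le_u]] := ex_zero_sumfree_few_max (u := u) (v := v).
  by rewrite pn_eq.
apply: leq_trans le_u; apply: Gamma_lb => //.
rewrite szS small_davenport_basis; lia.
Qed.

End Basis.

(** * From the isomorphism to a basis, and the theorem *)

(** The basis consists of the preimages of the unit vectors. Since ['Z_m] has m elements only for m
    > 1, the [n i] must exceed 1. *)
Lemma isog_Zp_basis (G : finZmodType) (I : finType) (n : I -> nat) :
  (forall i, 1 < n i)%N ->
  [set: G] \isog [set: {dffun forall i : I, 'Z_(n i)}] ->
  exists e : I -> G,
    [/\ forall i, e i *+ n i = 0,
        forall x, exists c : I -> nat, x = \sum_i e i *+ c i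
      & forall c : I -> nat, \sum_i e i *+ c i = 0 -> forall i, (n i %| c i)%N].
Proof.
move=> n_gt1 /isogP[f /injmP f_inj f_im].
have fD x y i : f (x + y) i = f x i + f y i.
  by rewrite (morphM f) ?inE // ffunE.
have f0 i : f 0 i = 0 by rewrite (morph1 f) ffunE.
have f_comb (F : I -> G) (c : I -> nat) j :
    f (\sum_i F i *+ c i) j = \sum_i f (F i) j *+ c i.
  rewrite (big_morph (fun x => f x j) (id1 := 0) (op1 := +%R)) => [|x y|] //.
  apply: eq_bigr => i _; elim: (c i) => [|m IHm]; first by rewrite !mulr0n.
  by rewrite !mulrS fD IHm.
have [e fe] : exists e : I -> G, forall i j, f (e i) j = (j == i)%:R.
  apply: (fin_all_exists (P := fun i x => forall j, f x j = (j == i)%:R)) => i.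
  pose y : {dffun forall j : I, 'Z_(n j)} := [ffun j : I => (j == i)%:R].
  have : y \in (f @* [set: G])%g by rewrite f_im inE.
  by case/morphimP => x _ _ y_x; exists x => j; rewrite -y_x ffunE.
have f_eq x y : (forall j, f x j = f y j) -> x = y.
  by move=> eq_f; apply: f_inj; rewrite ?inE //; apply/ffunP.
have f_e c j : f (\sum_i e i *+ c i) j = (c j)%:R.
  rewrite f_comb (bigD1 j) //= fe eqxx big1 ?addr0 // => i ne_i.
  by rewrite fe eq_sym (negPf ne_i) mul0rn.
have natr_Zp_eq0 i m : (m%:R == 0 :> 'Z_(n i)) = (n i %| m)%N.
  by rewrite -(inj_eq val_inj) /= val_Zp_nat.
exists e; split=> [i|x|c c0 i].
- apply: f_eq => j; rewrite f0.
  have -> : e i *+ n i = \sum_k e k *+ (if k == i then n i else 0).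
    by rewrite (bigD1 i) //= eqxx big1 ?addr0 // => k /negPf->.
  by rewrite f_e; case: eqP => // ->; apply/eqP; rewrite natr_Zp_eq0.
- by exists (fun i => (f x i : 'Z_(n i)) : nat); apply: f_eq => j; rewrite f_e natr_Zp.
by rewrite -natr_Zp_eq0 -f_e c0 f0.
Qed.

(* The exponents a_1, ..., a_r are the values a 1, ..., a r. *)
Theorem theorem2p6 (p r : nat) (a : nat -> nat) (G : finZmodType)
    (p_prime : prime p)
    (r_ge1 : (1 <= r)%N)
    (a1_ge1 : (1 <= a 1)%N)
    (a_nondecr : forall i : nat, (1 <= i)%N -> (i < r.-1)%N ->
                 (a i <= a i.+1)%N)
    (a_last : (1 < r)%N -> (a r.-1 < a r)%N)
    (G_iso : [set: G] \isog [set: {dffun forall i : 'I_r, 'Z_(p ^ a i.+1)}])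
    (delta : nat)
    (delta_le : (delta <= small_davenport G - 1)%N) :
  (Gamma delta G)%:Z =
    Num.max 0 (((p ^ a r)%N%:Z - 1) - delta%:Z - (delta %/ (p - 1))%N%:Z).
Proof.
(* After the shift to r + 1 summands, index i carries a_(i+1), and [ord_max] the strictly largest
   exponent. *)
case: r r_ge1 a_nondecr a_last G_iso => // r _ /= a_nondecr a_last G_iso.
have a_ge1 i : (i < r)%N -> (1 <= a i.+1)%N.
  elim: i => // i IHi lt_i; apply: leq_trans (IHi (ltnW lt_i)) _.
  exact: a_nondecr.
have a_le i j : (i <= j)%N -> (j < r)%N -> (a i.+1 <= a j.+1)%N.
  elim: j => [|j IHj]; first by rewrite leqn0 => /eqP->.
  rewrite leq_eqVlt => /predU1P[->//|]; rewrite ltnS => le_ij lt_j.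
  exact: leq_trans (IHj le_ij (ltnW lt_j)) (a_nondecr _ _ lt_j).
have a_lt i : (i < r)%N -> (a i.+1 < a r.+1)%N.
  case: (r) a_le a_last => // r' a_le a_last lt_i.
  by apply: leq_ltn_trans (a_le i r' _ _) (a_last _).
(* The last exponent is not covered by monotonicity: it is a_1 itself or exceeds a_1. *)
have a_gt0 (i : 'I_r.+1) : (0 < a i.+1)%N.
  have [/a_ge1//|le_ri] := ltnP i r.
  have -> : i = r :> nat by apply/eqP; rewrite eqn_leq le_ri -ltnS ltn_ord.
  by case: (posnP r) => [->|/a_lt] //; apply: leq_trans.
have n_gt1 (i : 'I_r.+1) : (1 < p ^ a i.+1)%N.
  by rewrite -(exp1n (a i.+1)) ltn_exp2r ?prime_gt1 ?a_gt0.
have [e [eb0 e_gen e_indep]] := isog_Zp_basis n_gt1 G_iso.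
rewrite (@Gamma_basis p G _ e (fun i : 'I_r.+1 => a i.+1) ord_max) //=.
(* Truncated subtraction on [nat] becomes the maximum with 0 over the integers. *)
- have : (0 < p ^ a r.+1)%N by rewrite expn_gt0 prime_gt0.
  by move: (p ^ _)%N (_ %/ _)%N => n k; lia.
- exact: (a_gt0 ord_max).
by move=> i ne_i; apply: a_lt; rewrite ltn_neqAle -ltnS ltn_ord andbT.
Qed.
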